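(* Let $\gamma>0$. Let $X_T$ be the value at time $T$ of the solution of an SDE and, for each step size $\Delta>0$, let $X_T^{\Delta}$ denote the value at time $T$ of a time-discrete approximation with time step $\Delta$, where $X_T$ and all the $X_T^{\Delta}$ are constructed from the same Wiener process. Then the following are equivalent: (i) there is a constant $C_1$, independent of $\Delta$, such that $E\left[(X_T-X_T^{\Delta})^2\right]<C_1\Delta^{\gamma}$ for all $\Delta>0$; (ii) the discretization is mean-square convergent, i.e. $\lim_{\Delta\to0}E\left[(X_T-X_T^{\Delta})^2\right]=0$, and for all $k>1$ there is a positive constant $C_2$, independent of $\Delta$, such that $E\left[(X_T^{\Delta}-X_T^{\Delta/k})^2\right]<C_2\Delta^{\gamma}$ for all $\Delta>0$, where $X_T^{\Delta/k}$ is the approximation with time step $\Delta/k$ built from the same Wiener process.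
   Context: $X_T$ and $X_T^{\Delta}$ ($\Delta>0$) are real-valued square-integrable random variables on one common probability space. Only the family $(X_T^{\Delta})_{\Delta>0}$ and $X_T$ enter the statement; no particular discretization scheme or SDE is assumed. The constant $C_2$ may depend on $k$. *)

(* Defs.v *)
From HB Require Import structures.
From mathcomp Require Import all_boot all_order all_algebra.
From mathcomp Require Import all_classical all_reals all_analysis.
Import numFieldNormedType.Exports.
Set Implicit Arguments.
Unset Strict Implicit.
Unset Printing Implicit Defensive.
Local Open Scope classical_set_scope.
Local Open Scope ring_scope.
Local Open Scope ereal_scope.

Definition mean_square_error (d : measure_display) (Omega : measurableType d)
    (R : realType) (P : probability Omega R) (X Y : Omega -> R) : \bar R :=
  'E_P[fun w => ((X w - Y w) ^+ 2)%R].

(* Main.v *)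
(* For (ii) => (i), write h for mean_square_error and choose k with
   k `^ gamma = 4.  Since h(X, Z) <= 2 h(X, Y) + 2 h(Y, Z), an induction on n
   bounds h(XD Delta, XD (Delta / k ^+ n)) by 4 C2 Delta `^ gamma uniformly in
   n: the factor 2 lost at each step is beaten by the gain of 4 on
   Delta `^ gamma.  For fixed Delta, convergence gives an n at which
   h(XT, XD (Delta / k ^+ n)) < C2 Delta `^ gamma. *)
Require Import Defs.
From HB Require Import structures.
From mathcomp Require Import all_boot all_order all_algebra.
From mathcomp Require Import all_classical all_reals all_analysis.
From mathcomp Require Import measurable_realfun ring lra.
Import numFieldNormedType.Exports.
Local Open Scope classical_set_scope.
Local Open Scope ring_scope.
Local Open Scope ereal_scope.
Import Order.TTheory GRing.Theory Num.Theory.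

Lemma mean_square_error_ge0 {d : measure_display} {Omega : measurableType d}
    {R : realType} (P : probability Omega R) (X Y : Omega -> R) :
  0 <= mean_square_error P X Y.
Proof. by apply: expectation_ge0 => w; exact: sqr_ge0. Qed.

Lemma mean_square_errorxx {d : measure_display} {Omega : measurableType d}
    {R : realType} (P : probability Omega R) (X : Omega -> R) :
  mean_square_error P X X = 0.
Proof.
rewrite /mean_square_error unlock integral0_eq// => w _.
by rewrite subrr expr0n.
Qed.

Lemma mean_square_errorC {d : measure_display} {Omega : measurableType d}
    {R : realType} (P : probability Omega R) (X Y : Omega -> R) :
  mean_square_error P X Y = mean_square_error P Y X.
Proof.
by congr expectation; apply/funext => w; rewrite -sqrrN opprB.
Qed.

(** With [a = X - Y] and [b = Y - Z], the pointwise identity [2 a^2 + 2 b^2 - (a + b)^2 = (a - b)^2]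
    is integrated. All integrands are nonnegative and measurable, so linearity and monotonicity hold
    directly in the extended reals. *)
Lemma mean_square_error_le {d : measure_display} {Omega : measurableType d}
    {R : realType} {P : probability Omega R} (X Y Z : {RV P >-> R}) :
  mean_square_error P X Z <=
  2%:E * mean_square_error P X Y + 2%:E * mean_square_error P Y Z.
Proof.
have sq_ge0 (U V : {RV P >-> R}) w : 0 <= ((U w - V w) ^+ 2)%:E.
  by rewrite lee_fin sqr_ge0.
have mfun (U V : {RV P >-> R}) :
    measurable_fun setT (fun w => (U w - V w) ^+ 2 : R)%R.
  apply: measurable_funX.
  exact: measurable_funB.
rewrite /mean_square_error unlock -!ge0_integralZl_EFin //; [|exact/measurable_EFinP/mfun..].
rewrite -ge0_integralD //.
- apply: ge0_le_integral => //.
  + exact/measurable_EFinP/mfun.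
  + by apply: emeasurable_funD; apply: measurable_funeM; exact/measurable_EFinP/mfun.
  + move=> w _; rewrite -!EFinM -EFinD lee_fin.
    rewrite -subr_ge0.
    have -> : (2 * (X w - Y w) ^+ 2 + 2 * (Y w - Z w) ^+ 2 - (X w - Z w) ^+ 2
        = (X w - 2 * Y w + Z w) ^+ 2)%R by ring.
    exact: sqr_ge0.
- by move=> w _; rewrite mule_ge0.
- by apply: measurable_funeM; exact/measurable_EFinP/mfun.
- by move=> w _; rewrite mule_ge0.
- by apply: measurable_funeM; exact/measurable_EFinP/mfun.
Qed.

Lemma mean_square_error_lt {d : measure_display} {Omega : measurableType d}
    {R : realType} {P : probability Omega R} {X Y Z : {RV P >-> R}} {a b : R} :
  mean_square_error P X Y < a%:E -> mean_square_error P Y Z < b%:E ->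
  mean_square_error P X Z < (2 * a + 2 * b)%:E.
Proof.
move=> XYa YZb; apply: (le_lt_trans (mean_square_error_le X Y Z)).
by rewrite [X in _ < X]EFinD !EFinM lteD// lte_pmul2l.
Qed.

Lemma mean_square_error_refinement {d : measure_display}
    {Omega : measurableType d} {R : realType} {P : probability Omega R}
    {X : R -> {RV P >-> R}} {gamma k C : R} :
  (0 < k)%R -> (k `^ gamma = 4)%R -> (0 < C)%R ->
  (forall D, (0 < D)%R ->
    mean_square_error P (X D) (X (D / k)%R) < (C * D `^ gamma)%:E) ->
  forall n D, (0 < D)%R ->
    mean_square_error P (X D) (X (D / k ^+ n)%R) < (4 * C * D `^ gamma)%:E.
Proof.
move=> k0 k4 C0 XC; elim=> [|n IHn] D D0.
  by rewrite expr0 divr1 mean_square_errorxx lte_fin !mulr_gt0// powR_gt0.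
have Dk0 : (0 < D / k)%R by rewrite divr_gt0.
(* The chain is cut after its first refinement, with the induction hypothesis at step [D / k]: the
   doubled tail then carries the factor [1 / 4]. A cut before the last refinement would double the
   accumulated bound instead. *)
have := mean_square_error_lt (XC _ D0) (IHn _ Dk0).
have -> : (D / k / k ^+ n = D / k ^+ n.+1)%R.
  by rewrite exprS invfM mulrA.
have -> : ((D / k) `^ gamma = D `^ gamma / 4)%R.
  by rewrite -k4 -[D in RHS](divfK (lt0r_neq0 k0)) [in RHS]powRM ?ltW// mulfK// k4.
by congr (_ < _%:E); field.
Qed.

Theorem theorem2p3 (R : realType) (d : measure_display)
    (Omega : measurableType d) (P : probability Omega R)
    (XT : {RV P >-> R}) (XD : R -> {RV P >-> R})
    (XT_L2 : (XT : Omega -> R) \in Lfun P 2%:E)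
    (XD_L2 : forall Delta : R, (0 < Delta)%R ->
       (XD Delta : Omega -> R) \in Lfun P 2%:E)
    (gamma : R) (gamma_gt0 : (0 < gamma)%R) :
  (exists C1 : R, forall Delta : R, (0 < Delta)%R ->
     mean_square_error P XT (XD Delta) < (C1 * Delta `^ gamma)%:E)
  <->
  (mean_square_error P XT (XD Delta) @[Delta --> (0 : R)%R^'+] --> (0 : \bar R)
   /\
   forall k : R, (1 < k)%R -> exists C2 : R, (0 < C2)%R /\
     forall Delta : R, (0 < Delta)%R ->
       mean_square_error P (XD Delta) (XD (Delta / k)%R)
         < (C2 * Delta `^ gamma)%:E).
Proof.
split=> [[C1 XC1]|[X0 XC2]].
(* The bound at step 1 reads [0 <= error < C1]. *)
- have C10 : (0 < C1)%R.
    have := le_lt_trans (mean_square_error_ge0 P XT (XD 1%R)) (XC1 1%R ltr01).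
    by rewrite powR1 mulr1 lte_fin.
  split.
    apply: (@squeeze_cvge _ _ _ _ (cst 0)
      _ (fun D => (C1 * D `^ gamma)%:E)); last 2 first.
    + exact: cvg_cst.
    + apply: cvg_EFin; first exact: nearW.
      rewrite -[X in _ --> X](mulr0 C1).
      exact: cvgM (cvg_cst C1) (powR_cvg0 gamma_gt0).
    + near=> D; by rewrite mean_square_error_ge0/= ltW// XC1.
  move=> k k1; have k0 : (0 < k)%R by rewrite (lt_trans _ k1).
  (* Passing through [XT] costs [2 * C1] at step [D] and [2 * C1] at step [D / k], and [(D / k)]^
     gamma <= D [^ gamma]. *)
  exists (4 * C1)%R; split=> [|D D0]; first by rewrite mulr_gt0.
  have Dk0 : (0 < D / k)%R by rewrite divr_gt0.
  have XDC : mean_square_error P (XD D) XT < (C1 * D `^ gamma)%:E.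
    by rewrite mean_square_errorC XC1.
  apply: (lt_le_trans (mean_square_error_lt XDC (XC1 _ Dk0))).
  rewrite lee_fin.
  have : ((D / k) `^ gamma <= D `^ gamma)%R.
    rewrite ge0_ler_powR ?nnegrE ?ltW//.
    by rewrite gtr_pMr// invf_lt1.
  move=> /(ler_wpM2l (ltW C10)); lra.
- pose k : R := (4 `^ gamma^-1)%R.
  have k4 : (k `^ gamma = 4)%R.
    by rewrite -powRrM mulVf ?gt_eqF// powRr1.
  have k1 : (1 < k)%R.
    have := @gt0_ltr_powR R _ (etrans (invr_gt0 _) gamma_gt0) 1%R 4%R.
    rewrite powR1; apply; rewrite ?nnegrE//; lra.
  have k0 : (0 < k)%R by rewrite (lt_trans _ k1).
  have [C2 [C20 XC]] := XC2 k k1.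
  (* Here [10 = 2 * 4 + 2]: twice the uniform refinement bound [4 * C2], plus twice the remaining
     error [C2]. *)
  exists (10 * C2)%R => D D0.
  have [n Xn] : exists n,
      mean_square_error P (XD (D / k ^+ n)%R) XT < (C2 * D `^ gamma)%:E.
    have eps0 : 0 < (C2 * D `^ gamma)%:E.
      by rewrite lte_fin mulr_gt0// powR_gt0.
    have Xeps : \forall h \near (0 : R)%R^'+,
      mean_square_error P XT (XD h) < (C2 * D `^ gamma)%:E.
      exact: (X0 _ (open_ereal_lt' eps0)).
    have Dn : geometric D k^-1%R x @[x --> \oo] --> (0 : R)%R.
      by apply: cvg_geometric; rewrite gtr0_norm ?invr_gt0// invf_lt1.
    (* A property near [0^'+] is one near 0 guarded by [0 < h]. The geometric steps tend to 0, so it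
       holds from some rank on and is taken at that rank; positivity of [D / k ^+ n] then discharges
       the guard. *)
    have [n _ /(_ n (leqnn n))/=] := Dn _ Xeps.
    rewrite exprVn mean_square_errorC => Xn.
    by exists n; apply: Xn; rewrite divr_gt0// exprn_gt0.
  rewrite mean_square_errorC.
  have := mean_square_error_lt
    (mean_square_error_refinement k0 k4 C20 XC n _ D0) Xn.
  by congr (_ < _%:E); ring.
Unshelve. all: end_near.
Qed.
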